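(* Let $q$ be a prime power. Let $(\ell,m)$ and $(\ell',m')$ be ordered pairs of non-tangent lines of $\mathcal O$ in $\mathrm{PG}(2,q)$ with $\ell\ne m$ and $\ell'\ne m'$. There exists an element of $G(\mathcal O)$ mapping $\ell$ to $\ell'$ and $m$ to $m'$ if and only if all of the following hold: (i) $\ell$ and $\ell'$ are of the same type; (ii) $m$ and $m'$ are of the same type; (iii) $\rho(\ell,m)=\rho(\ell',m')$.
   Context: Let $q$ be a prime power. Projective plane and conic. - Points of $\mathrm{PG}(2,K)$ are nonzero column vectors $(X,Y,Z)^\top$ up to nonzero scalars. - The line $(a,b,c)^\perp$ is $\{(X,Y,Z)^\top:aX+bY+cZ=0\}$. - $\mathrm{PG}(2,q)\subset\mathrm{PG}(2,q^2)$. - $P_\xi=(\xi,\xi^2,1)^\top$ for $\xi$ in an extension field of $\mathbb F_q$, and $P_\infty=(0,1,0)^\top$. - $\mathcal O_{q^m}=\{P_\xi:\xi\in\mathbb F_{q^m}\cup\{\infty\}\}$, and $\mathcal O=\mathcal O_q$. Line types. - A line of $\mathrm{PG}(2,q)$ is non-tangent if it meets $\mathcal O$ in $0$ or $2$ points. - Its type is hyperbolic (secant) if it meets $\mathcal O$ in $2$ points, and elliptic (exterior) if in $0$ points. - Each non-tangent line $\ell$, viewed in $\mathrm{PG}(2,q^2)$, meets $\mathcal O_{q^2}$ in exactly two points $P_\alpha,P_\beta$. The group. - $G(\mathcal O)$ is the image of $\mathrm{PGL}(2,q)$ in $\mathrm{PGL}(3,q)$ under $$\begin{pmatrix}a&b\\c&d\end{pmatrix}\mapsto\begin{pmatrix}ad+bc&ac&bd\\2ab&a^2&b^2\\2cd&c^2&d^2\end{pmatrix};$$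 it is the stabilizer of $\mathcal O$ in $\mathrm{PGL}(3,q)$. Cross-ratio. - With $v_x=(x,1)^\top$ and $v_\infty=(1,0)^\top$, for $\alpha,\beta,\gamma,\delta\in\mathbb F_{q^2}\cup\{\infty\}$ with no three equal, $\rho(\alpha,\beta,\gamma,\delta)$ is the element of $\mathrm{PG}(1,q^2)=\mathbb F_{q^2}\cup\{\infty\}$ represented by $(\det(v_\alpha,v_\gamma)\det(v_\beta,v_\delta),\ \det(v_\alpha,v_\delta)\det(v_\beta,v_\gamma))^\top$. For finite entries this equals $\frac{(\alpha-\gamma)(\beta-\delta)}{(\alpha-\delta)(\beta-\gamma)}$. - For distinct non-tangent lines $\ell,m$ with $\ell\cap\mathcal O_{q^2}=\{P_\alpha,P_\beta\}$ and $m\cap\mathcal O_{q^2}=\{P_\gamma,P_\delta\}$, set $\rho(\ell,m)=\{r,r^{-1}\}$ with $r=\rho(\alpha,\beta,\gamma,\delta)$, where $0^{-1}=\infty$. *)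

(* Defs.v *)
From HB Require Import structures.
From mathcomp Require Import all_boot all_fingroup all_algebra all_solvable.
From mathcomp Require Import ring.
Set Implicit Arguments.
Unset Strict Implicit.
Unset Printing Implicit Defensive.
Import GRing.Theory.
Local Open Scope ring_scope.

Section Plane.

Variable K : finFieldType.

(* The point represented by v, as the class of nonzero scalar multiples. *)
Definition pt n (v : 'cV[K]_n) : {set 'cV[K]_n} :=
  [set a *: v | a in [set a : K | a != 0]].

Definition cvec3 (X Y Z : K) : 'cV[K]_3 := \col_i [:: X; Y; Z]`_i.
Definition cvec2 (X Y : K) : 'cV[K]_2 := \col_i [:: X; Y]`_i.

(* (a, b, c)^\perp for w = (a, b, c). *)
Definition line (w : 'rV[K]_3) : {set {set 'cV[K]_3}} :=
  [set pt v | v in [set v : 'cV[K]_3 | (v != 0) && (w *m v == 0)]].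

Definition lines : {set {set {set 'cV[K]_3}}} :=
  [set line w | w in [set w : 'rV[K]_3 | w != 0]].

(* The parameter None stands for infinity, here and below. *)
Definition conic_pt (x : option K) : {set 'cV[K]_3} :=
  pt (if x is Some t then cvec3 t (t ^+ 2) 1 else cvec3 0 1 0).

Lemma conic_pt_inj : injective conic_pt.
Proof.
move=> x y e.
have : (if x is Some t then cvec3 t (t ^+ 2) 1 else cvec3 0 1 0) \in conic_pt y.
  rewrite -e; apply/imsetP; exists 1; first by rewrite inE oner_eq0.
  by rewrite scale1r.
case/imsetP=> k; rewrite inE => nzk {e}.
case: x y => [t|] [u|] // /colP ev; have := (ev 0, ev (lift 0 0), ev ord_max).
- rewrite !mxE /= mulr1 => -[[-> _] <-]; by rewrite mul1r.
- by rewrite !mxE /= mulr0 => -[_ /eqP]; rewrite oner_eq0.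
- rewrite !mxE /= mulr1 => -[[_ e1] e2].
  by move: nzk; rewrite -e2 eqxx.
Qed.

Definition conic : {set {set 'cV[K]_3}} :=
  [set conic_pt x | x in [set: option K]].

Definition hyperbolic (l : {set {set 'cV[K]_3}}) := #|l :&: conic| == 2%N.
Definition elliptic (l : {set {set 'cV[K]_3}}) := #|l :&: conic| == 0%N.
Definition non_tangent (l : {set {set 'cV[K]_3}}) := hyperbolic l || elliptic l.
Definition same_type (l l' : {set {set 'cV[K]_3}}) :=
  hyperbolic l && hyperbolic l' || elliptic l && elliptic l'.

Definition pvec (x : option K) : 'cV[K]_2 :=
  if x is Some t then cvec2 t 1 else cvec2 1 0.

Definition det2 (u v : 'cV[K]_2) : K := \det (row_mx u v : 'M_2).

(* The element of PG(1, K) represented by (X, Y)^T; (0, 0) is not a point. *)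
Definition of_homog (X Y : K) : option K :=
  if Y == 0 then None else Some (X / Y).

Definition inv_infty (x : option K) : option K :=
  if x is Some t then (if t == 0 then None else Some t^-1) else Some 0.

Definition cross_ratio (a b c d : option K) : option K :=
  of_homog (det2 (pvec a) (pvec c) * det2 (pvec b) (pvec d))
           (det2 (pvec a) (pvec d) * det2 (pvec b) (pvec c)).

Lemma det2E (u v : 'cV[K]_2) : det2 u v = u 0 0 * v 1 0 - u 1 0 * v 0 0.
Proof.
rewrite /det2; set M : 'M_2 := row_mx u v.
have Ml i : M i 0 = u i 0.
  by have -> : 0 = lshift 1 (0 : 'I_1) :> 'I_2; [apply/val_inj|exact: row_mxEl].
have Mr i : M i 1 = v i 0.
  by have -> : 1 = rshift 1 (0 : 'I_1) :> 'I_2; [apply/val_inj|exact: row_mxEr].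
have e1 : lift 0 0 = 1 :> 'I_2 by apply/val_inj.
have e2 : lift ord0 ord0 = 1 :> 'I_2 by apply/val_inj.
have e3 : lift (1 : 'I_2) (ord0 : 'I_1) = 0 by apply/val_inj.
have e0 : (ord0 : 'I_2) = 0 by [].
clearbody M; do 2 rewrite !(expand_det_row _ 0) !big_ord_recl !big_ord0 /cofactor.
rewrite !det_mx00 !mxE /= ?e1 ?e2 ?e3 ?e0 !Ml !Mr /bump /=; ring.
Qed.

Lemma det2_pvec_eq0 a b : (det2 (pvec a) (pvec b) == 0) = (a == b).
Proof.
rewrite det2E; case: a b => [a|] [b|] /=; rewrite !mxE /=.
- by rewrite mulr1 mul1r subr_eq0.
- by rewrite mulr0 mul1r sub0r oppr_eq0 oner_eq0.
- by rewrite mulr1 mul0r subr0 oner_eq0.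
by rewrite mulr0 mul0r subr0 !eqxx.
Qed.

Lemma of_homogC X Y : (X != 0) || (Y != 0) ->
  of_homog Y X = inv_infty (of_homog X Y).
Proof.
rewrite /of_homog; have [eX|nzX] := eqVneq X 0; have [eY|nzY] := eqVneq Y 0 => //= _.
- by rewrite eX mul0r eqxx.
- by rewrite eY mul0r.
by rewrite mulf_eq0 invr_eq0 (negPf nzX) (negPf nzY) /= invf_div.
Qed.

Lemma inv_inftyK : involutive inv_infty.
Proof.
case=> [t|] /=; last by rewrite eqxx.
have [->|nzt] := eqVneq t 0 => //=.
by rewrite invr_eq0 (negPf nzt) invrK.
Qed.

Lemma cross_ratioC a b c d : a != b -> c != d ->
  cross_ratio b a c d = inv_infty (cross_ratio a b c d).
Proof.
move=> nab ncd; rewrite /cross_ratio -of_homogC; last first.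
  rewrite !mulf_eq0 !det2_pvec_eq0 -negb_and; apply/negP.
  case/andP=> /orP[] /eqP e1 /orP[] /eqP e2; move: nab ncd.
  - by rewrite -e1 -e2 eqxx.
  - by rewrite e1 e2 eqxx.
  - by rewrite e1 e2 eqxx.
  - by rewrite -e1 -e2 eqxx.
by rewrite mulrC [X in of_homog _ X]mulrC.
Qed.

Lemma cross_ratioCr a b c d : a != b -> c != d ->
  cross_ratio a b d c = inv_infty (cross_ratio a b c d).
Proof.
by move=> nab ncd; rewrite -cross_ratioC // /cross_ratio mulrC [X in of_homog _ X]mulrC.
Qed.

End Plane.

Section Group.

Variable F : finFieldType.

(* The matrix whose projectivity sends the conic point of parameter t to that of
   parameter (a t + b) / (c t + d). *)
Definition sym2 (A : 'M[F]_2) : 'M[F]_3 :=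
  let a := A 0 0 in let b := A 0 1 in let c := A 1 0 in let d := A 1 1 in
  \matrix_(i, j)
    nth 0 (nth [::] [:: [:: a * d + b * c; a * c; b * d];
                        [:: 2 * a * b; a ^+ 2; b ^+ 2];
                        [:: 2 * c * d; c ^+ 2; d ^+ 2]] i) j.

Lemma det_sym2 A : \det (sym2 A) = (\det A) ^+ 3.
Proof.
do 3 rewrite !(expand_det_row _ 0) !big_ord_recl !big_ord0 /cofactor.
rewrite !det_mx00 !mxE /= /bump /=.
have e0 : (ord0 : 'I_2) = 0 by [].
have e1 : lift 0 0 = 1 :> 'I_2 by apply/val_inj.
have e2 : lift ord0 ord0 = 1 :> 'I_2 by apply/val_inj.
have e3 : lift (lift ord0 ord0) ord0 = 0 :> 'I_2 by apply/val_inj.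
rewrite ?e3 ?e1 ?e2 ?e0; ring.
Qed.

Lemma sym2_unit (A : {'GL_2[F]}) : (sym2 A : 'M_3) \is a GRing.unit.
Proof.
have : \det (sym2 A) \is a GRing.unit.
  by rewrite det_sym2 unitrX // unitfE; exact: (@GL_det 2 F A).
by rewrite -unitmxE.
Qed.

Definition sym2_GL (A : {'GL_2[F]}) : {'GL_3[F]} := FinRing.unit 'M[F]_3 (sym2_unit A).

Definition PGL3 := coset_of 'Z('GL_3[F])%g.

(* The image of PGL(2, q): scalar multiples of A give the same class. *)
Definition GO : {set PGL3} :=
  [set coset 'Z('GL_3[F])%g (sym2_GL A) | A in [set: {'GL_2[F]}]].

(* g is a class of matrices and P a class of vectors, both up to scalars. *)
Definition act_pt (g : PGL3) (P : {set 'cV[F]_3}) : {set 'cV[F]_3} :=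
  [set (GLval B : 'M_3) *m v |
    B : {'GL_3[F]} in (g : {set {'GL_3[F]}}), v : 'cV[F]_3 in P].

Definition act_line (g : PGL3) (l : {set {set 'cV[F]_3}}) : {set {set 'cV[F]_3}} :=
  [set act_pt g P | P in l].

End Group.

Section Extension.

Variables (F L : finFieldType) (iota : {rmorphism F -> L}).

(* l viewed over L: the union is over the scalar multiples of one (a, b, c),
   see ext_lineE. *)
Definition ext_line (l : {set {set 'cV[F]_3}}) : {set {set 'cV[L]_3}} :=
  \bigcup_(w : 'rV[F]_3 | (w != 0) && (line w == l)) line (map_mx iota w).

(* The pair does not depend on the labels a, b, c, d, see line_ratioE. *)
Definition line_ratio (l m : {set {set 'cV[F]_3}}) : {set option L} :=
  [set r | [exists a, exists b, exists c, exists d,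
    [&& ext_line l :&: conic L == [set conic_pt a; conic_pt b],
        ext_line m :&: conic L == [set conic_pt c; conic_pt d]
      & r \in [set cross_ratio a b c d; inv_infty (cross_ratio a b c d)]]]].

Lemma ext_lineE (w : 'rV[F]_3) : w != 0 ->
  ext_line (line w) = line (map_mx iota w).
Proof.
have sub (u w' : 'rV[F]_3) : line u = line w' -> w' != 0 -> u != 0 ->
    line (map_mx iota u) \subset line (map_mx iota w').
  move=> euw nzw nzu.
  suff /sub_rVP[a uE] : (w' <= u)%MS.
    apply/subsetP=> P /imsetP[v]; rewrite inE => /andP[nzv /eqP uv] ->.
    by apply: imset_f; rewrite inE nzv uE map_mxZ -scalemxAl uv scaler0 eqxx.
  rewrite submxE; apply/eqP/trmx_inj/row_matrixP=> j.
  rewrite -tr_col trmx0 row0; apply/trmx_inj; rewrite trmxK trmx0 colE.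
  rewrite -mulmxA -colE; set v := col j _.
  have uv : u *m v = 0 by rewrite /v colE mulmxA mulmx_coker mul0mx.
  have [->|nzv] := eqVneq v 0; first by rewrite mulmx0.
  have : pt v \in line w'.
    by rewrite -euw; apply: imset_f; rewrite inE nzv uv eqxx.
  case/imsetP=> v'; rewrite inE => /andP[_ /eqP wv'] epv.
  have : v \in pt v.
    by apply/imsetP; exists 1; rewrite ?inE ?oner_eq0 ?scale1r.
  by rewrite epv => /imsetP[a _ ->]; rewrite -scalemxAr wv' scaler0.
move=> nzw; apply/eqP; rewrite eqEsubset; apply/andP; split.
  by apply/bigcupsP=> u /andP[nzu /eqP]; move/sub; apply.
by apply: (bigcup_sup w) => //; rewrite nzw eqxx.
Qed.

Lemma line_ratioE (l m : {set {set 'cV[F]_3}}) (a b c d : option L) :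
    a != b -> c != d ->
    ext_line l :&: conic L = [set conic_pt a; conic_pt b] ->
    ext_line m :&: conic L = [set conic_pt c; conic_pt d] ->
  line_ratio l m = [set cross_ratio a b c d; inv_infty (cross_ratio a b c d)].
Proof.
move=> nab ncd el em.
have pairE (x y z t : option L) :
    [set conic_pt x; conic_pt y] = [set conic_pt z; conic_pt t] ->
  (x = z /\ y = t) \/ (x = t /\ y = z).
  move=> e; have memP u : (u == x) || (u == y) = (u == z) || (u == t).
    by rewrite -!(inj_eq (@conic_pt_inj L)) -!in_set2 e.
  have /esym := memP x; rewrite eqxx => /orP[] /eqP ex.
    left; split=> //; have /esym := memP y; rewrite eqxx orbT.
    case/orP=> /eqP ey //; have := memP t.
    by rewrite eqxx orbT ex ey orbb => /eqP.
  right; split=> //; have /esym := memP y; rewrite eqxx orbT.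
  case/orP=> /eqP ey //; have := memP z.
  by rewrite eqxx ex ey orbb => /eqP.
apply/setP=> r; rewrite inE; apply/idP/idP; last first.
  move=> rE; apply/existsP; exists a; apply/existsP; exists b.
  apply/existsP; exists c; apply/existsP; exists d.
  by rewrite el em !eqxx.
case/existsP=> a' /existsP[b' /existsP[c' /existsP[d' /and3P[]]]].
rewrite el em => /eqP/pairE eab /eqP/pairE ecd.
have [[<- <-]|[<- <-]] := eab; have [[<- <-]|[<- <-]] := ecd => //.
- by rewrite cross_ratioCr // inv_inftyK setUC.
- by rewrite cross_ratioC // inv_inftyK setUC.
have -> // : cross_ratio b a d c = cross_ratio a b c d.
by rewrite /cross_ratio mulrC [X in of_homog _ X]mulrC.
Qed.

End Extension.

(* Main.v *)
Require Import Defs.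
From HB Require Import structures.
From mathcomp Require Import all_boot all_fingroup all_algebra all_solvable.
From mathcomp Require Import all_field ring.
Set Implicit Arguments.
Unset Strict Implicit.
Unset Printing Implicit Defensive.
Import GRing.Theory.
Local Open Scope ring_scope.

(* A non-tangent line is a binary quadratic form over F up to scalars; it has two
   distinct roots in PG(1, q^2), both in PG(1, q) for a secant and exchanged by
   the Frobenius map sigma for an exterior line.  An element of G(O) is a Moebius
   map over F, and it sends a line to another iff it does so for their roots, so
   the cross ratio is invariant.  Conversely, three of the four roots and the
   cross ratio determine a Moebius map A over L sending roots to roots.  Equality
   of types means that sigma permutes both quadruples of roots in the same way, so
   sigma(A) agrees with A at three points and A is defined over F up to a scalar. *)

(** * Coordinates and determinants in dimensions two and three *)

Section Conic.

Variable K : finFieldType.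
Implicit Types (a b c d : option K) (u v : 'cV[K]_2) (w : 'rV[K]_3).
Implicit Types (A B : 'M[K]_2).

Lemma row3P w w' :
  w 0 0 = w' 0 0 -> w 0 (lift 0 0) = w' 0 (lift 0 0) ->
  w 0 ord_max = w' 0 ord_max -> w = w'.
Proof.
move=> e0 e1 e2; apply/rowP; case=> [[|[|[|//]]]] lt_j3.
- by rewrite (_ : Ordinal lt_j3 = 0) //; apply/val_inj.
- by rewrite (_ : Ordinal lt_j3 = lift 0 0) //; apply/val_inj.
by rewrite (_ : Ordinal lt_j3 = ord_max) //; apply/val_inj.
Qed.

Lemma col2P u v : u 0 0 = v 0 0 -> u 1 0 = v 1 0 -> u = v.
Proof.
move=> e0 e1; apply/colP; case=> [[|[|//]]] lt_j2.
  by rewrite (_ : Ordinal lt_j2 = 0) //; apply/val_inj.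
by rewrite (_ : Ordinal lt_j2 = 1) //; apply/val_inj.
Qed.

Lemma mulmx_col2 A u (i : 'I_2) :
  (A *m u) i 0 = A i 0 * u 0 0 + A i 1 * u 1 0.
Proof.
by rewrite mxE !big_ord_recl big_ord0 addr0 (_ : lift ord0 ord0 = 1) //; apply/val_inj.
Qed.

Lemma mulmx_row3 w (v : 'cV[K]_3) :
  w *m v = (w 0 0 * v 0 0 + w 0 (lift 0 0) * v (lift 0 0) 0
            + w 0 ord_max * v ord_max 0)%:M.
Proof.
apply/matrixP=> i j; rewrite !ord1 !mxE !big_ord_recl big_ord0 addr0 addrA.
by rewrite eqxx mulr1n (_ : lift ord0 (lift ord0 ord0) = ord_max) //; apply/val_inj.
Qed.

Lemma det2Z k l u v : det2 (k *: u) (l *: v) = k * l * det2 u v.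
Proof. rewrite !det2E !mxE; ring. Qed.

Lemma det2Dl u v x : det2 (u + v) x = det2 u x + det2 v x.
Proof. rewrite !det2E !mxE; ring. Qed.

Lemma det2C u v : det2 u v = - det2 v u.
Proof. rewrite !det2E; ring. Qed.

Lemma det2_mulmx A u v : det2 (A *m u) (A *m v) = \det A * det2 u v.
Proof. by rewrite /det2 -mul_mx_row det_mulmx. Qed.

Lemma det_mx2 A : \det A = A 0 0 * A 1 1 - A 0 1 * A 1 0.
Proof.
rewrite (expand_det_row _ 0) !big_ord_recl big_ord0 /cofactor !det_mx11 !mxE /=.
rewrite (_ : lift ord0 ord0 = 1); last exact/val_inj.
rewrite (_ : lift (1 : 'I_2) 0 = 0); last exact/val_inj.
rewrite /bump /=; ring.
Qed.

Lemma mulmx2_inj A B u v : det2 u v != 0 ->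
  A *m u = B *m u -> A *m v = B *m v -> A = B.
Proof.
move=> nz eu ev; have U : (row_mx u v : 'M_2) \in unitmx by rewrite unitmxE unitfE.
apply: (can_inj (mulmxK U)).
have e : A *m row_mx u v = B *m row_mx u v by rewrite !mul_mx_row eu ev.
exact: e.
Qed.

(** * The projective line, Moebius maps and the cross ratio *)

Lemma pvec_neq0 a : pvec a != 0.
Proof.
apply/eqP=> /colP e; case: a e => [t|] e.
  by have /eqP := e 1; rewrite !mxE /= oner_eq0.
by have /eqP := e 0; rewrite !mxE /= oner_eq0.
Qed.

Definition param u : option K := of_homog (u 0 0) (u 1 0).

Lemma of_homogZ k (X Y : K) : k != 0 -> of_homog (k * X) (k * Y) = of_homog X Y.
Proof.
move=> nzk; rewrite /of_homog mulf_eq0 (negPf nzk) /=.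
by case: eqVneq => // nzY; congr Some; rewrite -mulf_div divff // mul1r.
Qed.

Lemma of_homog_eq (X Y X' Y' : K) :
  (X != 0) || (Y != 0) -> (X' != 0) || (Y' != 0) ->
  (of_homog X Y == of_homog X' Y') = (X * Y' == X' * Y).
Proof.
rewrite /of_homog; have [->|nzY] := eqVneq Y 0; have [->|nzY'] := eqVneq Y' 0.
- by rewrite !mulr0 !eqxx.
- by rewrite orbF mulr0 mulf_eq0 (negPf nzY') orbF => /negPf ->.
- by rewrite orbF => _ nz; rewrite mulr0 [RHS]eq_sym mulf_eq0 (negPf nz) (negPf nzY).
by rewrite (inj_eq (@Some_inj _)) eqr_div.
Qed.

Lemma paramP u : u != 0 -> exists2 k, k != 0 & u = k *: pvec (param u).
Proof.
rewrite /param /of_homog => nzu; have [e1|nz1] := eqVneq (u 1 0) 0.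
  exists (u 0 0).
    by apply: contra_neq nzu => e0; apply: col2P; rewrite ?e0 ?e1 mxE.
  by apply: col2P; rewrite !mxE /= ?e1 ?mulr0 ?mulr1.
exists (u 1 0) => //.
by apply: col2P; rewrite !mxE /= ?mulr1 // mulrC divfK.
Qed.

Lemma param_eq u a : u != 0 -> (param u == a) = (det2 u (pvec a) == 0).
Proof.
case/paramP=> k nzk uE; rewrite [in RHS]uE -[pvec a]scale1r det2Z mulr1.
by rewrite mulf_eq0 (negPf nzk) det2_pvec_eq0.
Qed.

Lemma paramZpvec k a : k != 0 -> param (k *: pvec a) = a.
Proof.
move=> nzk; apply/eqP; rewrite param_eq.
  by rewrite -[X in det2 _ X]scale1r det2Z mulf_eq0 det2_pvec_eq0 eqxx orbT.
by rewrite scaler_eq0 (negPf nzk) pvec_neq0.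
Qed.

Definition moebius A a := param (A *m pvec a).

Lemma unitmx2_neq0 A u : A \in unitmx -> u != 0 -> A *m u != 0.
Proof.
by move=> U; apply: contra_neq => e; rewrite -(mulKmx U u) e mulmx0.
Qed.

Lemma moebiusP A a : A \in unitmx ->
  exists2 k, k != 0 & A *m pvec a = k *: pvec (moebius A a).
Proof. by move=> U; apply/paramP/unitmx2_neq0/pvec_neq0. Qed.

Lemma moebius_eq A a b : A \in unitmx ->
  (moebius A a == b) = (det2 (A *m pvec a) (pvec b) == 0).
Proof. by move=> U; apply/param_eq/unitmx2_neq0/pvec_neq0. Qed.

(** [A] multiplies every [det2] by the nonzero [\det A], and [det2] of two [pvec] vanishes only on
    equal parameters. *)
Lemma moebius_inj A : A \in unitmx -> injective (moebius A).
Proof.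
move=> U a b e; have [k nzk ak] := moebiusP a U; have [l nzl bl] := moebiusP b U.
apply/eqP; rewrite -det2_pvec_eq0; have nzA : \det A != 0 by rewrite -unitfE.
have /eqP := det2_mulmx A (pvec a) (pvec b).
rewrite ak bl e det2Z; have /eqP -> : det2 (pvec (moebius A b)) (pvec (moebius A b)) == 0.
  by rewrite det2_pvec_eq0.
by rewrite mulr0 eq_sym mulf_eq0 (negPf nzA).
Qed.

Lemma moebiusZ k A : k != 0 -> A \in unitmx -> moebius (k *: A) =1 moebius A.
Proof.
move=> nzk U a; have [l nzl e] := moebiusP a U.
by rewrite /moebius -scalemxAl e scalerA !paramZpvec // mulf_neq0.
Qed.

(** Numerator and denominator both gain the factor [\det A ^+ 2]. Each also contains all four
    vectors once, so the scalars that normalise the images to [pvec] are common to both and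
    cancel. *)
Lemma cross_ratio_moebius A a b c d : A \in unitmx ->
  cross_ratio (moebius A a) (moebius A b) (moebius A c) (moebius A d)
  = cross_ratio a b c d.
Proof.
move=> U; have nzA : \det A != 0 by rewrite -unitfE.
have [[ka nza ea] [kb nzb eb]] := (moebiusP a U, moebiusP b U).
have [[kc nzc ec] [kd nzd ed]] := (moebiusP c U, moebiusP d U).
rewrite /cross_ratio -(@of_homogZ (ka * kb * kc * kd)) ?mulf_neq0 //.
rewrite -[in RHS](@of_homogZ (\det A ^+ 2)) ?expf_neq0 //.
have sq x y z t : \det A ^+ 2 * (det2 x y * det2 z t) =
    det2 (A *m x) (A *m y) * det2 (A *m z) (A *m t).
  by rewrite !det2_mulmx; ring.
rewrite !sq ea eb ec ed !det2Z; congr of_homog; ring.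
Qed.

(* A^-1 B has three eigenlines. *)
Lemma moebius_uniq A B a b d : A \in unitmx -> B \in unitmx ->
    a != b -> a != d -> b != d ->
    moebius A a = moebius B a -> moebius A b = moebius B b ->
    moebius A d = moebius B d ->
  exists2 k, k != 0 & B = k *: A.
Proof.
move=> UA UB nab nad nbd ea eb ed; have nzA : \det A != 0 by rewrite -unitfE.
have mul x : moebius A x = moebius B x ->
    exists2 k, k != 0 & B *m pvec x = (k *: A) *m pvec x.
  move=> ex; have [[k nzk ak] [l nzl bl]] := (moebiusP x UA, moebiusP x UB).
  exists (l / k); first by rewrite mulf_neq0 ?invr_eq0.
  by rewrite bl -ex -scalemxAl ak scalerA divfK.
have [[[ka nza Ba] [kb _ Bb]] [kd _ Bd]] := (mul _ ea, mul _ eb, mul _ ed).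
exists ka => //.
(* [N] kills [pvec a], hence is singular. Its images of [pvec b] and [pvec d] are [kb - ka] and
   [kd - ka] times those under [A], so one of these scalars vanishes and [B] agrees with [ka *: A]
   on two independent vectors. *)
pose N := B - ka *: A.
have Na : N *m pvec a = 0 by rewrite mulmxBl Ba subrr.
have NE x k : B *m pvec x = (k *: A) *m pvec x ->
    N *m pvec x = (k - ka) *: (A *m pvec x).
  by move=> e; rewrite mulmxBl e -!scalemxAl scalerBl.
have detN : \det N = 0.
  have /eqP := det2_mulmx N (pvec a) (pvec b); rewrite Na -(scale0r 0) -[N *m _]scale1r.
  by rewrite det2Z !mul0r eq_sym mulf_eq0 det2_pvec_eq0 (negPf nab) orbF => /eqP.
have /esym/eqP := det2_mulmx N (pvec b) (pvec d).
rewrite detN mul0r (NE _ _ Bb) (NE _ _ Bd) det2Z det2_mulmx eq_sym !mulf_eq0.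
rewrite det2_pvec_eq0 (negPf nzA) (negPf nbd) !orbF !subr_eq0.
have inj (x y : option K) : x != y -> det2 (pvec x) (pvec y) != 0 by rewrite det2_pvec_eq0.
case/orP=> /eqP ke.
  by rewrite ke in Bb; exact: (mulmx2_inj (inj _ _ nab) Ba Bb).
by rewrite ke in Bd; exact: (mulmx2_inj (inj _ _ nad) Ba Bd).
Qed.

(* A is determined on a, b up to a diagonal matrix, whose entries (s, t) are
   fixed by requiring d to go to d'; the cross ratio then takes care of c. *)
Lemma moebius_exists a b c d a' b' c' d' :
    a != b -> a != d -> b != d -> a' != b' -> a' != d' -> b' != d' ->
    c != d -> c' != d' ->
    cross_ratio a b c d = cross_ratio a' b' c' d' ->
  exists2 A, A \in unitmx & [/\ moebius A a = a', moebius A b = b',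
                               moebius A c = c' & moebius A d = d'].
Proof.
move=> nab nad nbd nab' nad' nbd' ncd ncd' cr.
pose D (x y : option K) := det2 (pvec x) (pvec y).
have D0 x y : (D x y == 0) = (x == y) by rewrite /D det2_pvec_eq0.
have Dxx x : D x x = 0 by apply/eqP; rewrite D0.
have DC x y : D x y = - D y x by exact: det2C.
have nz x y : x != y -> D x y != 0 by rewrite D0.
(* By Cramer's rule [D d' b' *: pvec a' + D a' d' *: pvec b'] equals [D a' b' *: pvec d']; the
   factors [D a d] and [D d b] balance the coefficients of [A *m pvec d]. *)
pose s := D d' b' * D a d; pose t := D a' d' * D d b.
have nzs : s != 0 by rewrite mulf_neq0 ?nz // eq_sym.
have nzt : t != 0 by rewrite mulf_neq0 ?nz // eq_sym.
(* The linear functional [x |-> det2 x (pvec z)]. It vanishes at [z], so each of the two rank-one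
   terms of [A] kills one of [pvec a], [pvec b]. *)
pose perp (z : option K) : 'rV[K]_2 := \row_j [:: pvec z 1 0; - pvec z 0 0]`_j.
have perpE z x : perp z *m pvec x = (D x z)%:M.
  apply/matrixP=> i j; rewrite !ord1 mxE !big_ord_recl big_ord0 addr0 /D det2E.
  rewrite (_ : lift ord0 ord0 = 1); last exact/val_inj.
  by rewrite ![_%:M _ _]mxE eqxx mulr1n ![perp z _ _]mxE /=; ring.
pose A : 'M_2 := s *: (pvec a' *m perp b) - t *: (pvec b' *m perp a).
have AE x : A *m pvec x = (s * D x b) *: pvec a' + (t * D a x) *: pvec b'.
  rewrite mulmxBl -!scalemxAl -!mulmxA !perpE !mul_mx_scalar !scalerA.
  by rewrite (DC a x) mulrN scaleNr.
have U : A \in unitmx.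
  rewrite unitmxE unitfE; apply/eqP=> A0.
  have := det2_mulmx A (pvec a) (pvec b); rewrite A0 mul0r !AE !Dxx.
  rewrite !mulr0 !scale0r addr0 add0r det2Z => /eqP; apply/negP.
  by rewrite !mulf_neq0 //; apply: nz => //; rewrite eq_sym.
have img x x' : s * D x b * D a' x' + t * D a x * D b' x' = 0 -> moebius A x = x'.
  move=> e; apply/eqP; rewrite moebius_eq // AE det2Dl -[pvec x']scale1r !det2Z.
  by rewrite !mulr1 e.
(* Both coordinates of the cross ratio vanish only if [x = z = y]; thus [c] may coincide with [a] or
   [b]. *)
have homog_nz (x y z u : option K) : x != y -> x != u -> y != u ->
    (D x z * D y u != 0) || (D x u * D y z != 0).
  move=> nxy nxu nyu; rewrite !mulf_eq0 !D0 (negPf nxu) (negPf nyu) orbF -negb_and.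
  by apply: contra nxy => /andP[/eqP-> /eqP->].
exists A => //; split; apply: img; rewrite ?Dxx ?mulr0 ?mul0r ?addr0 ?add0r //.
  (* Cross-multiplied, the equality of cross ratios is up to sign the condition of [img] for [c] and
     [c']. *)
  have /eqP := cr; rewrite /cross_ratio of_homog_eq -?/(D _ _).
  - rewrite /s /t -subr_eq0 => /eqP e; rewrite -[RHS]oppr0 -[in RHS]e.
    by rewrite (DC d' b') (DC d b) (DC c b); ring.
  - exact: homog_nz.
  exact: homog_nz.
by rewrite /s /t (DC d' b') (DC d b); ring.
Qed.

(** * The Veronese embedding and lines as binary quadratic forms *)

Definition veronese u : 'cV[K]_3 :=
  cvec3 (u 0 0 * u 1 0) (u 0 0 ^+ 2) (u 1 0 ^+ 2).

(* The row of the quadratic form [x |-> det2 x u * det2 x v]. *)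
Definition polar u v : 'rV[K]_3 :=
  \row_j [:: - (u 0 0 * v 1 0 + u 1 0 * v 0 0); u 1 0 * v 1 0; u 0 0 * v 0 0]`_j.

Lemma polar_veronese u v x : polar u v *m veronese x = (det2 x u * det2 x v)%:M.
Proof. by rewrite mulmx_row3 !det2E !mxE /=; congr _%:M; ring. Qed.

Lemma veroneseZ k u : veronese (k *: u) = k ^+ 2 *: veronese u.
Proof.
apply/trmx_inj/row3P; rewrite !mxE /=; ring.
Qed.

Lemma conic_ptE a : conic_pt a = pt (veronese (pvec a)).
Proof.
rewrite /conic_pt; congr pt; apply/trmx_inj/row3P; case: a => [t|];
  rewrite !mxE /=; ring.
Qed.

Lemma veronese_neq0 a : veronese (pvec a) != 0.
Proof.
apply/eqP=> /colP e; case: a e => [t|] e.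
  by have /eqP := e ord_max; rewrite !mxE /= expr1n oner_eq0.
by have /eqP := e (lift 0 0); rewrite !mxE /= expr1n oner_eq0.
Qed.

(** [sym2 A] is the symmetric square of [A] in these coordinates; this turns the action on the conic
    into Moebius maps of parameters. *)
Lemma sym2_veronese A u : sym2 A *m veronese u = veronese (A *m u).
Proof.
apply/trmx_inj/row3P; rewrite mxE /veronese !mulmx_col2 mxE !big_ord_recl big_ord0
  !mxE /=; ring.
Qed.

(** Pulling back along [A] the form with roots [A *m u] and [A *m v] restores the roots [u] and [v];
    each of the two linear factors contributes one [\det A]. *)
Lemma polar_sym2 A u v :
  polar (A *m u) (A *m v) *m sym2 A = (\det A) ^+ 2 *: polar u v.
Proof.
rewrite det_mx2.
apply/row3P; rewrite /polar !mulmx_col2 mxE !big_ord_recl big_ord0 !mxE /=; ring.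
Qed.

Lemma polarZ k l u v : polar (k *: u) (l *: v) = (k * l) *: polar u v.
Proof. apply/row3P; rewrite !mxE /=; ring. Qed.

Lemma polarC u v : polar u v = polar v u.
Proof. apply/row3P; rewrite !mxE /=; ring. Qed.

Definition form_roots w := [set a | w *m veronese (pvec a) == 0].

Lemma roots_polar k a b : k != 0 ->
  form_roots (k *: polar (pvec a) (pvec b)) = [set a; b].
Proof.
move=> nzk; apply/setP=> x; rewrite !inE -scalemxAl polar_veronese scaler_eq0.
rewrite (negPf nzk) /= -!det2_pvec_eq0 -mulf_eq0.
by rewrite -[_%:M]scalemx1 scaler_eq0 oner_eq0 orbF.
Qed.

(** Vanishing at two distinct points leaves a one-dimensional space of binary quadratic forms. *)
Lemma two_roots w a b : w != 0 -> a != b -> a \in form_roots w -> b \in form_roots w ->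
  exists2 k, k != 0 & w = k *: polar (pvec a) (pvec b).
Proof.
move=> nzw nab ra rb.
suff [k wE] : exists k, w = k *: polar (pvec a) (pvec b).
  exists k => //; apply: contra_neq nzw => k0; by rewrite wE k0 scale0r.
have rE c : c \in form_roots w ->
    w 0 0 * veronese (pvec c) 0 0 + w 0 (lift 0 0) * veronese (pvec c) (lift 0 0) 0
    + w 0 ord_max * veronese (pvec c) ord_max 0 = 0.
  rewrite inE mulmx_row3 -[_%:M]scalemx1 scaler_eq0 oner_eq0 orbF => /eqP //.
have := rE _ ra; have := rE _ rb; move: nab; rewrite /veronese; clear.
case: a b => [s|] [t|] //; rewrite !mxE /=.
(* For finite roots the middle entry of [polar] is 1, which fixes the scalar. Subtracting the two
   equations and cancelling [s - t] gives the first entry. *)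
- rewrite (inj_eq (@Some_inj _)) => nst e1 e2; exists (w 0 (lift 0 0)).
  have e0 : w 0 0 = - w 0 (lift 0 0) * (s + t).
    apply: (mulfI (_ : s - t != 0)); first by rewrite subr_eq0.
    by apply/eqP; rewrite -subr_eq0 -(subrr 0) -{1}e2 -e1; apply/eqP; ring.
  apply/row3P; rewrite !mxE /=; [rewrite e0; ring|ring|].
  by apply/eqP; rewrite -subr_eq0 -e1 e0; apply/eqP; ring.
(* A root at infinity kills the coefficient of the square, and the first entry of [polar] is now
   -1. *)
- move=> _ e1 e2; exists (- w 0 0).
  have {}e1 : w 0 (lift 0 0) = 0 by rewrite -[RHS]e1; ring.
  apply/row3P; rewrite !mxE /=; [ring|rewrite e1; ring|].
  by apply/eqP; rewrite -subr_eq0 -e2 e1; apply/eqP; ring.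
move=> _ e2 e1; exists (- w 0 0).
have {}e1 : w 0 (lift 0 0) = 0 by rewrite -[RHS]e1; ring.
apply/row3P; rewrite !mxE /=; [ring|rewrite e1; ring|].
by apply/eqP; rewrite -subr_eq0 -e2 e1; apply/eqP; ring.
Qed.

(** * Lines of the plane and their points on the conic *)

Lemma mem_pt n (v : 'cV[K]_n) : v \in pt v.
Proof. by apply/imsetP; exists 1; rewrite ?inE ?oner_eq0 ?scale1r. Qed.

Lemma mem_line w (v : 'cV[K]_3) : (pt v \in line w) = (v != 0) && (w *m v == 0).
Proof.
apply/idP/idP=> [/imsetP[v'] | H]; last by apply: imset_f; rewrite inE.
rewrite inE => /andP[nzv' /eqP wv'] e; have := mem_pt v; rewrite e.
case/imsetP=> k; rewrite inE => nzk ->.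
by rewrite scaler_eq0 (negPf nzk) nzv' -scalemxAr wv' scaler0 eqxx.
Qed.

Lemma line_conic w : line w :&: conic K = @conic_pt K @: form_roots w.
Proof.
apply/setP=> P; apply/setIP/imsetP=> [[lP /imsetP[a _ eP]] | [a ra ->]].
  exists a => //; move: lP; rewrite eP conic_ptE mem_line => /andP[_ ?].
  by rewrite inE.
split; last exact: imset_f.
by rewrite conic_ptE mem_line veronese_neq0; move: ra; rewrite inE.
Qed.

Lemma hyperbolicE w : hyperbolic (line w) = (#|form_roots w| == 2).
Proof. by rewrite /hyperbolic line_conic card_imset //; apply: conic_pt_inj. Qed.

Lemma ellipticE w : elliptic (line w) = (#|form_roots w| == 0).
Proof. by rewrite /elliptic line_conic card_imset //; apply: conic_pt_inj. Qed.

Lemma roots_sym2 w A : A \in unitmx ->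
  form_roots (w *m sym2 A) = moebius A @^-1: form_roots w.
Proof.
move=> U; apply/setP=> a; rewrite !inE -mulmxA sym2_veronese.
have [k nzk ->] := moebiusP a U.
by rewrite veroneseZ -scalemxAr scaler_eq0 expf_eq0 (negPf nzk).
Qed.

Lemma card_roots_sym2 w A : A \in unitmx -> #|form_roots (w *m sym2 A)| = #|form_roots w|.
Proof.
move=> U; rewrite roots_sym2 // on_card_preimset //.
have [g gK Kg] := injF_bij (moebius_inj U).
by exists g => x _; [apply: gK|apply: Kg].
Qed.

Lemma polar_moebius A a b : A \in unitmx ->
  exists2 k, k != 0 & polar (pvec (moebius A a)) (pvec (moebius A b)) *m sym2 A
                      = k *: polar (pvec a) (pvec b).
Proof.
move=> U; have [[k nzk ea] [l nzl eb]] := (moebiusP a U, moebiusP b U).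
have nzA : \det A != 0 by rewrite -unitfE.
exists ((k * l)^-1 * \det A ^+ 2).
  by rewrite mulf_neq0 ?invr_eq0 ?expf_neq0 ?mulf_neq0.
by rewrite -scalerA -polar_sym2 ea eb polarZ -scalemxAl scalerA mulVf ?scale1r ?mulf_neq0.
Qed.

(** The columns of [cokermx w] are killed by [w], so the nonzero ones give points of the line and
    are killed by [w'] too; this places [w'] in the row space of [w]. *)
Lemma line_sub w w' : line w = line w' -> exists k, w' = k *: w.
Proof.
move=> e; suff /sub_rVP : (w' <= w)%MS by [].
rewrite submxE; apply/eqP/matrixP=> i j.
rewrite [RHS]mxE ord1; transitivity (col j (w' *m cokermx w) 0 0); first by rewrite [RHS]mxE.
rewrite colE -mulmxA -colE; have [->|nz] := eqVneq (col j (cokermx w)) 0.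
  by rewrite mulmx0 mxE.
have : pt (col j (cokermx w)) \in line w.
  by rewrite mem_line nz colE mulmxA mulmx_coker mul0mx /=.
by rewrite e mem_line => /andP[_ /eqP->]; rewrite mxE.
Qed.

Lemma lineZ k w : k != 0 -> line (k *: w) = line w.
Proof.
move=> nzk; rewrite /line (_ : [set _ | _] = [set v | (v != 0) && (w *m v == 0)]) //.
apply/setP=> v; by rewrite !inE -scalemxAl scaler_eq0 (negPf nzk).
Qed.

Lemma line_eqP w w' : w' != 0 ->
  line w = line w' <-> exists2 k, k != 0 & w' = k *: w.
Proof.
move=> nzw'; split=> [/line_sub[k e] | [k nzk ->]]; last by rewrite lineZ.
by exists k => //; apply: contra_neq nzw' => k0; rewrite e k0 scale0r.
Qed.

End Conic.

(** * The action of G(O) on points and lines *)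

Section GroupAction.

Variable F : finFieldType.
Implicit Types (w : 'rV[F]_3) (v : 'cV[F]_3).

(** Commuting with the transvections [1 + delta_mx i j] is commuting with the off-diagonal matrix
    units; comparing entries then leaves only scalar matrices. *)
Lemma center_GL_scalar n (z : {'GL_n.+1[F]}) : z \in 'Z('GL_n.+1[F])%g ->
  exists2 a, a != 0 & GLval z = a%:M.
Proof.
case/centerP=> _ zC; pose M : 'M[F]_n.+1 := GLval z.
have zE i j : i != j -> M *m delta_mx i j = delta_mx i j *m M.
  move=> nij; have U : (1 + delta_mx i j : 'M[F]_n.+1) \is a GRing.unit.
    suff /mulmx1_unit[]: (1 + delta_mx i j) *m (1 - delta_mx i j) = 1%:M :> 'M[F]_n.+1.
      by [].
    rewrite mulmxBr mulmxDl !mulmx1 mulmxDl mul1mx mul_delta_mx_0 1?eq_sym //.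
    by rewrite addr0 addrK.
  have := zC (FinRing.unit 'M[F]_n.+1 U); rewrite in_setT => /(_ isT)/(congr1 val) /=.
  by rewrite mulrDr mulrDl mulr1 mul1r => /addrI.
have M0 i j : i != j -> M i j = 0.
  move=> nij; have /matrixP/(_ i i) := zE _ _ (contra_neq (@esym _ _ _) nij).
  rewrite !mxE (bigD1 j) //= big1 => [|k nk]; last by rewrite !mxE (negPf nk) mulr0.
  rewrite mxE !eqxx mulr1 addr0 => ->; rewrite big1 // => k _.
  by rewrite mxE (negPf nij) mul0r.
have Mii i : M i i = M ord0 ord0.
  have [->//|n0] := eqVneq i ord0; have /matrixP/(_ i ord0) := zE _ _ n0.
  rewrite !mxE (bigD1 i) //= big1 => [|k nk]; last by rewrite !mxE (negPf nk) mulr0.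
  rewrite (bigD1 ord0) //= big1 => [|k nk]; last by rewrite !mxE (negPf nk) andbF mul0r.
  by rewrite !mxE !eqxx mulr1 mul1r !addr0.
have ME : M = (M ord0 ord0)%:M.
  apply/matrixP=> i j; rewrite mxE; have [<-|nij] := eqVneq i j; first exact: Mii.
  exact: M0.
exists (M ord0 ord0) => //; apply: contraTneq (GL_unit z) => M00.
rewrite -[val z]/M ME M00 unitmxE (_ : 0%:M = 0); last by rewrite raddf0.
by rewrite det0 unitr0.
Qed.

(** The representatives of a class differ by scalars, which the point absorbs. *)
Lemma act_pt_coset (B : {'GL_3[F]}) v :
  act_pt (coset 'Z('GL_3[F])%g B) (pt v) = pt (GLval B *m v).
Proof.
have NB : B \in 'N('Z('GL_3[F]))%g.
  by rewrite (subsetP (normal_norm (center_normal _))) ?in_setT.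
apply/setP=> y; rewrite /act_pt val_coset //; apply/imset2P/imsetP.
  case=> C x /rcosetP[z /center_GL_scalar[a nza zE] ->] /imsetP[k].
  rewrite inE => nzk -> ->; exists (a * k); first by rewrite inE mulf_neq0.
  rewrite GL_MxE zE mul_scalar_mx -scalemxAl -scalemxAr scalerA //.
case=> k nzk ->; exists B (k *: v); last by rewrite -scalemxAr.
  exact: rcoset_refl.
by apply/imsetP; exists k.
Qed.

(** Row vectors transform contragrediently; taking the source line as a pullback keeps inverse
    matrices out of the statement. *)
Lemma act_line_sym2 (A : {'GL_2[F]}) w :
  act_line (coset 'Z('GL_3[F])%g (sym2_GL A)) (line (w *m sym2 (GLval A))) = line w.
Proof.
have U : sym2 (GLval A) \in unitmx by exact: sym2_unit.
apply/setP=> P; apply/imsetP/imsetP.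
  case=> Q /imsetP[v]; rewrite inE => /andP[nzv wv] -> ->.
  exists (sym2 (GLval A) *m v); last by rewrite act_pt_coset.
  rewrite inE mulmxA wv andbT.
  by apply: contra_neq nzv => e; rewrite -(mulKmx U v) e mulmx0.
case=> v; rewrite inE => /andP[nzv wv] ->.
exists (pt (invmx (sym2 (GLval A)) *m v)).
  rewrite mem_line -mulmxA mulKVmx // wv andbT.
  by apply: contra_neq nzv => e; rewrite -(mulKVmx U v) e mulmx0.
by rewrite act_pt_coset mulKVmx.
Qed.

Lemma GO_lineP w1 w2 w1' w2' :
    w1 != 0 -> w2 != 0 ->
  (exists g : PGL3 F, [/\ g \in GO F, act_line g (line w1) = line w1'
                        & act_line g (line w2) = line w2'])
  <-> (exists2 A : 'M[F]_2, A \in unitmx &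
        (exists2 k, k != 0 & w1 = k *: (w1' *m sym2 A)) /\
        (exists2 k, k != 0 & w2 = k *: (w2' *m sym2 A))).
Proof.
move=> nz1 nz2; split=> [[_ [/imsetP[A _ ->]]] | [A U [[k nzk ->] [k' nzk' ->]]]].
  have U : sym2 (GLval A) \in unitmx by exact: sym2_unit.
  have act w w' : w != 0 ->
      act_line (coset 'Z('GL_3[F])%g (sym2_GL A)) (line w) = line w' ->
      exists2 k, k != 0 & w = k *: (w' *m sym2 (GLval A)).
    move=> nzw; rewrite -{1}[w](mulmxKV U) act_line_sym2 => /esym/line_sub[k e].
    have wE : w = k *: (w' *m sym2 (GLval A)) by rewrite scalemxAl -e mulmxKV.
    by exists k => //; apply: contra_neq nzw => k0; rewrite wE k0 scale0r.
  move=> /(act _ _ nz1) e1 /(act _ _ nz2) e2; exists (GLval A) => //.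
  by rewrite unitmxE unitfE; exact: (@GL_det 2 F A).
exists (coset 'Z('GL_3[F])%g (sym2_GL (FinRing.unit 'M[F]_2 U))); split.
- exact: imset_f.
- by rewrite lineZ //; apply: (act_line_sym2 (FinRing.unit 'M[F]_2 U)).
by rewrite lineZ //; apply: (act_line_sym2 (FinRing.unit 'M[F]_2 U)).
Qed.

End GroupAction.

(** * Compatibility with field morphisms *)

Section Morphism.

Variables (K1 K2 : finFieldType) (f : {rmorphism K1 -> K2}).
Implicit Types (a b : option K1) (u : 'cV[K1]_2) (w : 'rV[K1]_3).

Lemma map_pvec a : map_mx f (pvec a) = pvec (omap f a).
Proof. by case: a => [t|]; apply: col2P; rewrite !mxE /= ?rmorph1 ?rmorph0. Qed.

Lemma map_veronese u : map_mx f (veronese u) = veronese (map_mx f u).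
Proof.
by apply/trmx_inj/row3P; rewrite !mxE /= ?rmorphM // rmorphXn.
Qed.

Lemma map_sym2 (A : 'M[K1]_2) : map_mx f (sym2 A) = sym2 (map_mx f A).
Proof.
apply/matrixP=> i j; rewrite !mxE.
case: i j => [[|[|[|//]]]] ? [[|[|[|//]]]] ? /=;
  by rewrite ?rmorphD ?rmorphXn ?rmorphM ?rmorph_nat.
Qed.

Lemma param_map u : param (map_mx f u) = omap f (param u).
Proof.
rewrite /param /of_homog !mxE fmorph_eq0; case: eqVneq => //= _.
by rewrite fmorph_div.
Qed.

Lemma moebius_map A a : moebius (map_mx f A) (omap f a) = omap f (moebius A a).
Proof. by rewrite /moebius -map_pvec -map_mxM param_map. Qed.

Lemma mem_roots_map w a : (omap f a \in form_roots (map_mx f w)) = (a \in form_roots w).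
Proof. by rewrite !inE -map_pvec -map_veronese -map_mxM map_mx_eq0. Qed.

(** If [u] is nonzero, the scalar is a quotient of two entries, hence comes from [K1]; if [u] is
    zero, so is [v]. *)
Lemma map_mx_scale m n (u v : 'M[K1]_(m, n)) k :
  map_mx f v = k *: map_mx f u -> exists l, v = l *: u.
Proof.
have [->|] := eqVneq u 0.
  rewrite map_mx0 scaler0 => /eqP; rewrite map_mx_eq0 => /eqP ->.
  by exists 0; rewrite scaler0.
case/matrix0Pn=> i [j nz] e; have kE : k = f (v i j / u i j).
  have /matrixP/(_ i j) := e; rewrite !mxE fmorph_div => ->.
  by rewrite mulfK // fmorph_eq0.
by exists (v i j / u i j); apply: (map_mx_inj (f := f)); rewrite e kE map_mxZ.
Qed.

End Morphism.

(** * The Frobenius map as a ring morphism *)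

Section Frobenius.

Variables (L : finFieldType) (n : nat).

(* The phantom argument lets the ring morphism structure be inferred. *)
Definition frob (_ : [pchar L].-nat n) (x : L) := x ^+ n.

Hypothesis charLn : [pchar L].-nat n.

Lemma frob_is_zmod_morphism : zmod_morphism (frob charLn).
Proof.
by move=> x y; rewrite /frob -{2}(subrK y x) (exprDn_pchar (x - y)) ?addrK.
Qed.

Lemma frob_is_monoid_morphism : monoid_morphism (frob charLn).
Proof. by split=> [|x y]; rewrite /frob ?expr1n ?exprMn. Qed.

HB.instance Definition _ :=
  GRing.isZmodMorphism.Build L L (frob charLn) frob_is_zmod_morphism.
HB.instance Definition _ :=
  GRing.isMonoidMorphism.Build L L (frob charLn) frob_is_monoid_morphism.

End Frobenius.

(** * Roots of lines over the quadratic extension, and descent to [F] *)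

Section QuadraticExtension.

Variables (F L : finFieldType) (iota : {rmorphism F -> L}).
Hypothesis cardL : #|L| = (#|F| ^ 2)%N.
Hypothesis charLF : [pchar L].-nat #|F|.

Let sigma : {rmorphism L -> L} := frob charLF.

Lemma frob_iota x : sigma (iota x) = iota x.
Proof. by rewrite /= /frob -rmorphXn expf_card. Qed.

(** ['X^#|F| - 'X] is the product of the ['X - y%:P] over all [y] in [F], so its roots in [L] are
    the images of elements of [F]. *)
Lemma frob_fixed x : sigma x = x -> exists y, x = iota y.
Proof.
move=> sx; have : root (map_poly iota ('X^#|F| - 'X)) x.
  by rewrite rmorphB /= map_polyXn map_polyX /root !hornerE -[X in X - x]/(sigma x) sx subrr.
rewrite finField_genPoly rmorph_prod /= (eq_bigr (fun y => 'X - (iota y)%:P)); last first.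
  by move=> y _; rewrite map_polyXsubC.
rewrite -(big_map iota predT (fun y => 'X - y%:P)) root_prod_XsubC.
by case/mapP=> y _ ->; exists y.
Qed.

Lemma frobK : involutive sigma.
Proof. by move=> x; rewrite /= /frob -exprM mulnn -cardL expf_card. Qed.

(** Size 3 means degree 2, so the field [F[X]/f] has as many elements as [L]. The class of ['X] is
    then fixed by the power [#|L|], hence [f] divides ['X^#|L| - 'X], which splits over [L]. *)
Lemma irreducible_root (f : {poly F}) :
    f \is monic -> size f = 3 -> irreducible_poly f ->
  exists x, root (map_poly iota f) x.
Proof.
move=> fM sf fI; have hI : monic_irreducible_poly f by [].
have e : in_qpoly f ('X^#|L| - 'X) = 0.
  pose x : {poly %/ f with hI} := in_qpoly f 'X.
  have : x ^+ #|{poly %/ f with hI}| = x by exact: expf_card.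
  rewrite card_qfpoly sf -cardL /x => ex.
  by rewrite raddfB /= rmorphXn /= [X in X - _]ex subrr.
have : f %| 'X^#|L| - 'X.
  move/(congr1 val): e; rewrite /= mk_monicE // -Pdiv.IdomainMonic.modpE //.
  by move/eqP.
rewrite -(dvdp_map iota) rmorphB /= map_polyXn map_polyX finField_genPoly.
(* An empty product of linear factors would make [f] constant. *)
case/dvdp_prod_XsubC=> s; case: (mask s _) => [|x r].
  by rewrite big_nil => /eqp_size; rewrite size_map_poly sf size_poly1.
rewrite big_cons => /eqp_root e1; exists x.
by rewrite e1 rootM root_XsubC eqxx.
Qed.

Lemma no_root_ext (w : 'rV[F]_3) : form_roots w = set0 ->
  exists x : L, Some x \in form_roots (map_mx iota w).
Proof.
(* Since infinity is not a root, the form dehomogenises to a genuine quadratic, made monic by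
   [c]. *)
move=> r0; have nz : w 0 (lift 0 0) != 0.
  apply/eqP=> w0; have : None \in form_roots w.
    by rewrite inE mulmx_row3 !mxE /= w0 !(mulr0, mul0r, mulr1, expr0n) ?addr0 raddf0.
  by rewrite r0 inE.
pose c : F := (w 0 (lift 0 0))^-1.
pose f : {poly F} := 'X^2 + ((c * w 0 0) *: 'X + (c * w 0 ord_max)%:P).
have szr : (size ((c * w 0%R 0%R) *: 'X + (c * w 0%R ord_max)%:P)%R < 3)%N.
  rewrite (leq_ltn_trans (size_polyD _ _)) // gtn_max.
  rewrite (leq_ltn_trans (size_scale_leq _ _)) ?size_polyX //.
  by rewrite (leq_ltn_trans (size_polyC_leq1 _)).
have sf : size f = 3 by rewrite size_polyDl size_polyXn.
have fM : f \is monic.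
  by rewrite monicE lead_coefDl ?lead_coefXn // size_polyXn.
(* Used with [idfun] to see that [f] has no root in [F], hence is irreducible, and with [iota] to
   carry the root found in [L] back to the form. *)
have fE (E : finFieldType) (h : {rmorphism F -> E}) x :
    root (map_poly h f) x = (Some x \in form_roots (map_mx h w)).
  rewrite inE mulmx_row3 -[_%:M]scalemx1 scaler_eq0 oner_eq0 orbF /root.
  rewrite !rmorphD /= map_polyXn map_polyC map_polyZ map_polyX !hornerE !mxE /=.
  rewrite -[in RHS](mulrI_eq0 _ (lregP (_ : h c != 0))) ?fmorph_eq0 ?invr_eq0 //.
  congr (_ == 0); rewrite /c !rmorphM fmorphV; field.
  by rewrite fmorph_eq0.
have [|x] := irreducible_root fM sf.
  apply: cubic_irreducible; rewrite ?sf // => x.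
  have := fE F idfun x; rewrite map_poly_id // => ->.
  by rewrite map_mx_id // r0 inE.
by rewrite fE; exists x.
Qed.

(* The pair is conjugate over F, and made of F-points exactly when [h] holds. *)
Definition conj_pair (h : bool) (a b : option L) :=
  [/\ a != b, omap sigma a = (if h then a else b)
    & omap sigma b = (if h then b else a)].

Lemma conj_pairC h a b : conj_pair h a b -> conj_pair h b a.
Proof. by case: h => -[nab sa sb]; split; rewrite // eq_sym. Qed.

Lemma non_tangent_pair (w : 'rV[F]_3) : w != 0 -> non_tangent (line w) ->
  exists a b, conj_pair (hyperbolic (line w)) a b /\
    exists2 k, k != 0 & map_mx iota w = k *: polar (pvec a) (pvec b).
Proof.
move=> nzw; have nzi : map_mx iota w != 0 by rewrite map_mx_eq0.
rewrite /non_tangent; have [hyp _ | nhyp /= ell] := boolP (hyperbolic (line w)).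
  have := hyp; rewrite hyperbolicE => /cards2P[x [y [nxy rE]]].
  have oinj : injective (omap iota).
    by move=> [s|] [t|] //= [] /fmorph_inj ->.
  have oK z : omap sigma (omap iota z) = omap iota z.
    by case: z => //= t; congr Some; apply: frob_iota.
  exists (omap iota x), (omap iota y); split.
    by split; rewrite ?oK // (inj_eq oinj).
  by apply: two_roots; rewrite ?(inj_eq oinj) // mem_roots_map rE !inE eqxx ?orbT.
have r0 : form_roots w = set0 by apply/eqP; rewrite -cards_eq0 -ellipticE.
have [x rx] := no_root_ext r0.
(* A root fixed by [sigma] would come from [F], where an exterior line has none. The conjugate
   [sigma x] is a root because [w] has entries in [F]. *)
have nsx : x != sigma x.
  apply/eqP=> /esym/frob_fixed[y xE].
  by have := mem_roots_map iota w (Some y); rewrite /= -xE rx r0 inE.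
exists (Some x), (Some (sigma x)); split.
  by split=> //=; congr Some; apply: frobK.
apply: two_roots => //.
have -> : map_mx iota w = map_mx sigma (map_mx iota w).
  by apply/rowP=> j; rewrite !mxE frob_iota.
by rewrite (mem_roots_map sigma _ (Some x)).
Qed.

(* Dividing by a nonzero entry makes a projectively sigma-invariant matrix
   sigma-invariant. *)
Lemma frob_descent (A : 'M[L]_2) k : A \in unitmx -> k != 0 ->
    map_mx sigma A = k *: A ->
  exists2 B : 'M[F]_2, B \in unitmx & exists2 l, l != 0 & map_mx iota B = l *: A.
Proof.
move=> U nzk e; have nzA : A != 0.
  by apply: contraTneq U => ->; rewrite unitmxE det0 unitr0.
case/matrix0Pn: nzA => i [j nz].
pose C := (A i j)^-1 *: A.
have fixC r s : [exists y, C r s == iota y].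
  apply/existsP; have [|y ->] := @frob_fixed (C r s); last by exists y.
  have sA r' s' : sigma (A r' s') = k * A r' s'.
    by have /matrixP/(_ r' s') := e; rewrite !mxE.
  by rewrite !mxE rmorphM fmorphV !sA invfM mulrACA mulVf ?mul1r.
pose B : 'M[F]_2 := \matrix_(r, s) xchoose (existsP (fixC r s)).
have BE : map_mx iota B = C.
  apply/matrixP=> r s; rewrite [LHS]mxE [B _ _]mxE; apply/esym/eqP.
  exact: (xchooseP (existsP (fixC r s))).
exists B; last by exists (A i j)^-1; rewrite ?invr_eq0.
by rewrite -(map_unitmx iota) BE unitmxZ // unitfE invr_eq0.
Qed.

Lemma moebius_exists_rat h1 h2 a b c d a' b' c' d' :
    conj_pair h1 a b -> conj_pair h2 c d ->
    conj_pair h1 a' b' -> conj_pair h2 c' d' ->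
    a != d -> b != d -> a' != d' -> b' != d' ->
    cross_ratio a b c d = cross_ratio a' b' c' d' ->
  exists2 B : 'M[F]_2, B \in unitmx & let A := map_mx iota B in
    [/\ moebius A a = a', moebius A b = b', moebius A c = c' & moebius A d = d'].
Proof.
move=> [nab sa sb] [ncd sc sd] [nab' sa' sb'] [ncd' sc' sd'] nad nbd nad' nbd' cr.
have [A U [Aa Ab Ac Ad]] :=
  moebius_exists nab nad nbd nab' nad' nbd' ncd ncd' cr.
have sU : map_mx sigma A \in unitmx by rewrite map_unitmx.
have sA x x' y y' : omap sigma x = y -> omap sigma x' = y' -> moebius A x = x' ->
    moebius (map_mx sigma A) y = y'.
  by move=> <- <- <-; apply: moebius_map.
(* The three test points are [a], [b], [d]. When a flag is false [sigma] exchanges the pair, so the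
   value of the conjugate map at one point comes from that of [A] at its partner; this is where [c]
   enters. *)
have [k nzk e] : exists2 k, k != 0 & map_mx sigma A = k *: A.
  apply: (moebius_uniq U sU nab nad nbd); apply/esym; rewrite ?Aa ?Ab ?Ad.
  - by case: h1 sa sb sa' sb' => *; [apply: sA Aa|apply: sA Ab].
  - by case: h1 sa sb sa' sb' => *; [apply: sA Ab|apply: sA Aa].
  by case: h2 sc sd sc' sd' => *; [apply: sA Ad|apply: sA Ac].
have [B UB [l nzl BE]] := frob_descent U nzk e.
by exists B => //=; rewrite BE; split; rewrite moebiusZ.
Qed.

Lemma ext_line_conic (w : 'rV[F]_3) a b k : w != 0 -> k != 0 ->
    map_mx iota w = k *: polar (pvec a) (pvec b) ->
  ext_line iota (line w) :&: conic L = [set conic_pt a; conic_pt b].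
Proof.
by move=> nzw nzk e; rewrite ext_lineE // line_conic e roots_polar // imsetU1 imset_set1.
Qed.

Lemma same_roots_line (w1 w2 : 'rV[F]_3) a b k1 k2 :
    w2 != 0 -> k1 != 0 ->
    map_mx iota w1 = k1 *: polar (pvec a) (pvec b) ->
    map_mx iota w2 = k2 *: polar (pvec a) (pvec b) ->
  line w1 = line w2.
Proof.
move=> nz2 nzk1 e1 e2; apply/line_eqP => //.
have [l lE] : exists l, w2 = l *: w1.
  apply: (@map_mx_scale _ _ iota _ _ _ _ (k2 / k1)).
  by rewrite e2 e1 scalerA divfK.
by exists l => //; apply: contra_neq nz2 => l0; rewrite lE l0 scale0r.
Qed.

(** From roots back to lines: over [L] both rows are multiples of one [polar], and the ratio
    descends to [F]. *)
Lemma sym2_scale (w w' : 'rV[F]_3) (B : 'M[F]_2) a b k k' :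
    B \in unitmx -> w != 0 -> k' != 0 ->
    map_mx iota w = k *: polar (pvec a) (pvec b) ->
    map_mx iota w' = k' *: polar (pvec (moebius (map_mx iota B) a))
                                 (pvec (moebius (map_mx iota B) b)) ->
  exists2 l, l != 0 & w = l *: (w' *m sym2 B).
Proof.
move=> U nzw nzk' e e'; have UB : map_mx iota B \in unitmx by rewrite map_unitmx.
have [l nzl lE] := polar_moebius a b UB.
have [m mE] : exists m, w = m *: (w' *m sym2 B).
  apply: (@map_mx_scale _ _ iota _ _ _ _ (k / (k' * l))).
  rewrite map_mxM map_sym2 e' -scalemxAl lE e !scalerA -(mulrA _ k') divfK //.
  by rewrite mulf_neq0.
by exists m => //; apply: contra_neq nzw => m0; rewrite mE m0 scale0r.
Qed.

(** From lines to roots: the invertible [sym2] is cancelled in the pulled-back equation for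
    [polar]. *)
Lemma sym2_polar_pair (w w' : 'rV[F]_3) (B : 'M[F]_2) a b k l :
    B \in unitmx -> k != 0 -> l != 0 ->
    w = l *: (w' *m sym2 B) -> map_mx iota w = k *: polar (pvec a) (pvec b) ->
  exists2 k', k' != 0 &
    map_mx iota w' = k' *: polar (pvec (moebius (map_mx iota B) a))
                                 (pvec (moebius (map_mx iota B) b)).
Proof.
move=> U nzk nzl -> e; have UB : map_mx iota B \in unitmx by rewrite map_unitmx.
have [m nzm mE] := polar_moebius a b UB.
have US : sym2 (map_mx iota B) \in unitmx.
  by rewrite unitmxE unitfE det_sym2 expf_neq0 // -unitfE.
exists (k / (iota l * m)).
  by rewrite mulf_neq0 // invr_eq0 mulf_neq0 // fmorph_eq0.
apply: (can_inj (mulmxK US)); apply: (scalerI (_ : iota l != 0)).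
  by rewrite fmorph_eq0.
rewrite -scalemxAl mE -map_sym2 -map_mxM -map_mxZ e !scalerA; congr (_ *: _).
by rewrite invfM; field; rewrite nzm fmorph_eq0.
Qed.

End QuadraticExtension.

(** * Pairs of lines and their four roots *)

Section Pairs.

Variables (F L : finFieldType) (iota : {rmorphism F -> L}).
Hypothesis cardL : #|L| = (#|F| ^ 2)%N.
Hypothesis charLF : [pchar L].-nat #|F|.

Local Notation conj_pair := (conj_pair charLF).

Definition polar_line (w : 'rV[F]_3) (a b : option L) :=
  exists2 k, k != 0 & map_mx iota w = k *: polar (pvec a) (pvec b).

Lemma polar_lineC w a b : polar_line w a b -> polar_line w b a.
Proof. by case=> k nzk e; exists k; rewrite // polarC. Qed.

Lemma line_ratio_polar w1 w2 a b c d : w1 != 0 -> w2 != 0 ->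
    a != b -> c != d -> polar_line w1 a b -> polar_line w2 c d ->
  line_ratio iota (line w1) (line w2)
  = [set cross_ratio a b c d; inv_infty (cross_ratio a b c d)].
Proof.
move=> nz1 nz2 nab ncd [k nzk e1] [l nzl e2].
by apply: line_ratioE; [| |exact: ext_line_conic e1|exact: ext_line_conic e2].
Qed.

(* Choosing [d] off the first line makes all labels usable in [moebius_exists],
   even when the two lines meet on the conic. *)
Lemma pair_of_lines (w1 w2 : 'rV[F]_3) : w1 != 0 -> w2 != 0 ->
    non_tangent (line w1) -> non_tangent (line w2) -> line w1 != line w2 ->
  exists a b c d, [/\ conj_pair (hyperbolic (line w1)) a b,
    conj_pair (hyperbolic (line w2)) c d, polar_line w1 a b, polar_line w2 c d
    & a != d /\ b != d].
Proof.
move=> nz1 nz2 nt1 nt2 dw.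
have [a [b [Cab Pab]]] := non_tangent_pair iota cardL charLF nz1 nt1.
have [c [d [Ccd Pcd]]] := non_tangent_pair iota cardL charLF nz2 nt2.
have [/andP[nad nbd]|] := boolP ((a != d) && (b != d)); first by exists a, b, c, d.
rewrite negb_and !negbK => dP.
have [/andP[nac nbc]|] := boolP ((a != c) && (b != c)).
  exists a, b, d, c; split=> //; first exact: conj_pairC.
  exact: polar_lineC.
rewrite negb_and !negbK => cP; case/eqP: dw.
(* Both [c] and [d] now lie in [{a, b}], so the two lines share both roots. *)
have [k nzk e1] := Pab; have [l nzl e2] : polar_line w2 a b.
  case: Ccd => ncd _ _; case/orP: dP cP => /eqP-> /orP[] /eqP e //.
  - by rewrite e eqxx in ncd.
  - by rewrite e; apply: polar_lineC.
  - by rewrite e.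
  by rewrite e eqxx in ncd.
exact: same_roots_line e1 e2.
Qed.

(** The sets determine the cross ratio only up to inversion. In the inverse case exchanging [a'] and
    [b'] restores equality, while [d'] stays off both of them. *)
Lemma moebius_pairs h1 h2 a b c d a' b' c' d' :
    conj_pair h1 a b -> conj_pair h2 c d ->
    conj_pair h1 a' b' -> conj_pair h2 c' d' ->
    a != d -> b != d -> a' != d' -> b' != d' ->
    [set cross_ratio a b c d; inv_infty (cross_ratio a b c d)]
    = [set cross_ratio a' b' c' d'; inv_infty (cross_ratio a' b' c' d')] ->
  exists2 B : 'M[F]_2, B \in unitmx & let A := map_mx iota B in
    [/\ (moebius A a, moebius A b) = (a', b') \/
        (moebius A a, moebius A b) = (b', a'),
        moebius A c = c' & moebius A d = d'].
Proof.
move=> Cab Ccd Cab' Ccd' nad nbd nad' nbd' /setP/(_ (cross_ratio a b c d)).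
rewrite !inE eqxx /= => /esym/orP[] /eqP cr.
  have [B U [Ba Bb Bc Bd]] :=
    moebius_exists_rat iota Cab Ccd Cab' Ccd' nad nbd nad' nbd' cr.
  by exists B => //=; rewrite Ba Bb; split=> //; left.
rewrite -cross_ratioC in cr; [|by case: Cab'|by case: Ccd'].
have [B U [Ba Bb Bc Bd]] :=
  moebius_exists_rat iota Cab Ccd (conj_pairC Cab') Ccd' nad nbd nbd' nad' cr.
by exists B => //=; rewrite Ba Bb; split=> //; right.
Qed.

End Pairs.

Lemma same_typeE (F : finFieldType) (l l' : {set {set 'cV[F]_3}}) :
  non_tangent l -> non_tangent l' -> same_type l l' = (hyperbolic l == hyperbolic l').
Proof.
have excl (m : {set {set 'cV[F]_3}}) : non_tangent m -> elliptic m = ~~ hyperbolic m.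
  by rewrite /non_tangent /hyperbolic /elliptic; case: #|_| => [|[|[|]]].
move=> nt nt'; rewrite /same_type !excl //.
by case: (hyperbolic l); case: (hyperbolic l').
Qed.

Theorem mainTheorem2
  (q p e : nat) (p_prime : prime p) (e_gt0 : (0 < e)%N) (qE : q = (p ^ e)%N)
  (F L : finFieldType) (iota : {rmorphism F -> L})
  (cardF : #|F| = q) (cardL : #|L| = (q ^ 2)%N)
  (l m l' m' : {set {set 'cV[F]_3}})
  (l_line : l \in lines F) (m_line : m \in lines F)
  (l'_line : l' \in lines F) (m'_line : m' \in lines F)
  (l_nt : non_tangent l) (m_nt : non_tangent m)
  (l'_nt : non_tangent l') (m'_nt : non_tangent m')
  (lDm : l != m) (l'Dm' : l' != m') :
  (exists g : PGL3 F, [/\ g \in GO F, act_line g l = l' & act_line g m = m'])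
  <->
  [/\ same_type l l', same_type m m'
    & line_ratio iota l m = line_ratio iota l' m'].
Proof.
have cardLF : #|L| = (#|F| ^ 2)%N by rewrite cardF.
(* [q] is a power of the characteristic of [L], so raising to the power [q] is additive. *)
have charLF : [pchar L].-nat #|F|.
  have pF : p \in [pchar F] by apply: card_finPcharP p_prime; rewrite cardF qE.
  rewrite cardF qE pnatX (eq_pnat _ (pcharf_eq (rmorph_pchar iota pF))).
  by rewrite pnat_id.
rewrite (same_typeE l_nt l'_nt) (same_typeE m_nt m'_nt).
case/imsetP: l_line lDm l_nt => w1; rewrite inE => nz1 -> {l} lDm l_nt.
case/imsetP: m_line lDm m_nt => w2; rewrite inE => nz2 -> {m} lDm m_nt.
case/imsetP: l'_line l'Dm' l'_nt => w1'; rewrite inE => nz1' -> {l'} l'Dm' l'_nt.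
case/imsetP: m'_line l'Dm' m'_nt => w2'; rewrite inE => nz2' -> {m'} l'Dm' m'_nt.
rewrite (GO_lineP w1' w2' nz1 nz2).
have [a [b [c [d [Cab Ccd Pab Pcd [nad nbd]]]]]] :=
  pair_of_lines iota cardLF charLF nz1 nz2 l_nt m_nt lDm.
have [[nab _ _] [ncd _ _]] := (Cab, Ccd).
split=> [[B U [[k nzk e1] [k' nzk' e2]]] | [/eqP h1 /eqP h2 rE]].
  (* Types are preserved because the Moebius map of [B] permutes the parameters over [F], keeping
     the number of roots. *)
  have hypE (w w' : 'rV[F]_3) j : j != 0 -> w = j *: (w' *m sym2 B) ->
      hyperbolic (line w) == hyperbolic (line w').
    by move=> nzj ->; rewrite lineZ // !hyperbolicE card_roots_sym2.
  have UB : map_mx iota B \in unitmx by rewrite map_unitmx.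
  split; [exact: hypE e1|exact: hypE e2|].
  have [[i nzi Ei] [j nzj Ej]] := (Pab, Pcd).
  rewrite (line_ratio_polar nz1 nz2 nab ncd Pab Pcd).
  (* The images of [a], [b], [c], [d] serve as labels for the second pair of lines. *)
  have P1 := sym2_polar_pair U nzi nzk e1 Ei.
  have P2 := sym2_polar_pair U nzj nzk' e2 Ej.
  rewrite (line_ratio_polar nz1' nz2' _ _ P1 P2) ?(inj_eq (moebius_inj UB)) //.
  by rewrite cross_ratio_moebius.
have [a' [b' [c' [d' [Cab' Ccd' Pab' Pcd' [nad' nbd']]]]]] :=
  pair_of_lines iota cardLF charLF nz1' nz2' l'_nt m'_nt l'Dm'.
have [[nab' _ _] [ncd' _ _]] := (Cab', Ccd').
rewrite (line_ratio_polar nz1 nz2 nab ncd Pab Pcd) in rE.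
rewrite (line_ratio_polar nz1' nz2' nab' ncd' Pab' Pcd') in rE.
(* Equality of types puts both quadruples under the same flags, so [sigma] permutes them alike. *)
rewrite -h1 in Cab'; rewrite -h2 in Ccd'.
have [B U [Bab Bc Bd]] := moebius_pairs iota Cab Ccd Cab' Ccd' nad nbd nad' nbd' rE.
have [[i _ Ei] [j _ Ej]] := (Pab, Pcd).
have [j' nzj' Ej'] := Pcd'; rewrite -Bc -Bd in Ej'.
exists B => //; split; last exact: sym2_scale Ej Ej'.
(* The roots of [w1'] may arrive exchanged, which [polar] does not see. *)
have {}Pab' : polar_line iota w1' (moebius (map_mx iota B) a) (moebius (map_mx iota B) b).
  by case: Bab => -[-> ->] //; apply: polar_lineC.
by case: Pab' => i' nzi' Ei'; apply: sym2_scale Ei Ei'.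
Qed.
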